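(* Let $k\ge 1$ be an integer, let $0<\lambda<1$, and let $p,q\in[1,\infty]$. Let $T^\lambda$ be the operator defined on finitely supported functions $f:\mathbb{Z}^{2k+1}\to\mathbb{C}$ by $$T^\lambda f(n,t)=\sum_{m\in\mathbb{Z}^{2k},\ m\neq 0}\frac{f(n-m,\,t-\omega(n,m))}{|m|^{2k\lambda}},\qquad (n,t)\in\mathbb{Z}^{2k}\times\mathbb{Z}.$$ If $T^\lambda$ extends to a bounded operator from $\ell^p(\mathbb{Z}^{2k+1})$ to $\ell^q(\mathbb{Z}^{2k+1})$, then both of the following conditions hold: (i) $\frac1q\le\frac1p-\frac{2k(1-\lambda)}{2k+2}$; (ii) $\frac1q<\lambda$ and $\frac1p>1-\lambda$.
   Context: $\mathbb{Z}^{2k+1}$ is identified with $\mathbb{Z}^{2k}\times\mathbb{Z}$. For $n=(n_1,n_2)$ and $m=(m_1,m_2)$ in $\mathbb{Z}^k\times\mathbb{Z}^k$, $\omega(n,m)=2(n_2\cdot m_1-n_1\cdot m_2)$ is the symplectic bilinear form (with $\cdot$ the usual dot product), and $|m|$ denotes the Euclidean norm of $m\in\mathbb{Z}^{2k}$. The statement that $T^\lambda$ extends to a bounded operator from $\ell^p$ to $\ell^q$ means that there is a constant $A$ with $\|T^\lambda f\|_{\ell^q}\le A\|f\|_{\ell^p}$ for all finitely supported $f$. The convention $1/\infty=0$ is used. *)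

(* Defs.v *)
From mathcomp Require Import all_boot all_order all_algebra.
From mathcomp Require Import all_classical all_reals all_analysis.
From mathcomp Require Import complex.

Set Implicit Arguments.
Unset Strict Implicit.
Unset Printing Implicit Defensive.

Import Order.TTheory GRing.Theory Num.Theory.

Local Open Scope classical_set_scope.
Local Open Scope ring_scope.

(* Z^(2k), kept as Z^k x Z^k so that omega is readable. *)
Notation Z2k k := ('rV[int]_k * 'rV[int]_k)%type.

(* Z^(2k+1) = Z^(2k) x Z. *)
Notation Z2k1 k := (Z2k k * int)%type.

Definition dot (k : nat) (u v : 'rV[int]_k) : int :=
  \sum_(i < k) u 0 i * v 0 i.

Definition omega (k : nat) (n m : Z2k k) : int :=
  2 * (dot n.2 m.1 - dot n.1 m.2).

(* The library norm `|m| on pairs and matrices is a sup norm, hence this. *)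
Definition enorm (R : realType) (k : nat) (m : Z2k k) : R :=
  Num.sqrt (dot m.1 m.1 + dot m.2 m.2)%:~R.

Definition finitely_supported (R : realType) (X : Type) (f : X -> R[i]) : Prop :=
  finite_set [set x | f x != 0].

(* \sum_(m \in _) sums over the m with a nonzero term when these are finitely
   many (and is 0 otherwise).  For finitely supported f they are finitely many
   for each (n, t), since n - m must lie in a finite set. *)
Definition T_lambda (R : realType) (k : nat) (lambda : R) (f : Z2k1 k -> R[i])
    (x : Z2k1 k) : R[i] :=
  let: (n, t) := x in
  \sum_(m \in [set m : Z2k k | m != 0])
    (f (n - m, t - omega n m)
       / real_complex R (enorm R m `^ (2 * k%:R * lambda))).

(* The value at p = -oo is irrelevant: only 1 <= p is used. *)
Definition lnorm (R : realType) (X : choiceType) (p : \bar R) (f : X -> R[i]) :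
    \bar R :=
  match p with
  | p%:E => ((\esum_(x in [set: X]) (Normc.normc (f x) `^ p)%:E)
              `^ p^-1)%E
  | +oo%E => ereal_sup [set (Normc.normc (f x))%:E | x in [set: X]]
  | -oo%E => 0%E
  end.

Definition extends_bounded (R : realType) (X Y : choiceType)
    (T : (X -> R[i]) -> (Y -> R[i])) (p q : \bar R) : Prop :=
  exists A : R, forall f : X -> R[i], finitely_supported f ->
    (lnorm q (T f) <= A%:E * lnorm p f)%E.

(* Main.v *)
Require Import Defs.
From mathcomp Require Import all_boot all_order all_algebra.
From mathcomp Require Import all_classical all_reals all_analysis.
From mathcomp Require Import complex.
From mathcomp Require Import zify ring lra.
Import Order.TTheory GRing.Theory Num.Theory.
Local Open Scope ring_scope.

(** The operator has a nonnegative kernel, so a bound from l^p to l^q can be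
    tested on nonnegative functions, and there every partial sum over m bounds
    T f from below ([T_lambda_ge_sum]).  [bounded_test] packages this: any
    finitely supported g gives one real inequality between weighted sums.
    Three choices of g give the three conclusions.

    - A point mass at the origin is mapped to |m|^(-2k lambda) on the slice
      t = 0, because omega(m, m) = 0.  If 1/q were at least lambda, the q-th
      powers would dominate |m|^(-2k), whose sum over Z^(2k) diverges
      ([bounded_expo_q]).
    - Dually, let g be |m|^(-2k(1 - lambda)) on a large finite set S of the
      slice t = 0.  Since omega(0, m) = 0, the value of T g at the origin is
      the sum c of |m|^(-2k) over S.  If 1/p were at most 1 - lambda, the l^p
      norm of g would be at most c^(1 - lambda), so that c^lambda would stay
      bounded although c does not ([bounded_expo_p]).
    - For the scaling condition, g is the indicator of a box with sides of
      order N in the Z^(2k) directions and N^2 in the central direction.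
      As omega is O(N^2) on vectors of size N, T g is at least a constant times
      N^(2k(1 - lambda)) on a comparable box, and both boxes have about N^(2k+2)
      points.  Comparing powers of N as N grows gives the inequality
      ([box_inequality], [bounded_scaling]).

    Once the norms are estimated from above and below in terms of w^(1/p)
    ([lnorm_le_seq], [lnorm_ge_seq]), finite and infinite exponents are treated
    alike: for p = +oo the number 1/p is 0 and w^(1/p) is 1. *)

Set Implicit Arguments.
Unset Strict Implicit.

(** * Norms of finitely supported functions *)

(** The reciprocal 1/p as a real number, with value 0 at p = +oo. *)
Definition expo (R : realType) (p : \bar R) : R := fine (p^-1)%E.

Lemma expoE (R : realType) (p : \bar R) : (1 <= p)%E -> (p^-1)%E = (expo p)%:E.
Proof.
rewrite /expo; case: p => [r| |] //.
by rewrite lee_fin inver => r1; rewrite gt_eqF // (lt_le_trans ltr01).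
Qed.

Lemma expoy (R : realType) : expo (+oo%E : \bar R) = 0.
Proof. by rewrite /expo invey. Qed.

Lemma expo_fin (R : realType) (r : R) : expo r%:E = r^-1.
Proof. by rewrite /expo fine_invr. Qed.

Lemma normc_ge0 (R : realType) (z : R[i]) : 0 <= Normc.normc z.
Proof. by case: z => a b; exact: sqrtr_ge0. Qed.

Lemma normc_real (R : realType) (x : R) : Normc.normc (real_complex R x) = `|x|.
Proof. by rewrite /= expr0n addr0 sqrtr_sqr. Qed.

(** Bounding f by w^(1/p), rather than f^p by w, makes the estimate uniform in
    p: for p = +oo it says that f is at most 1. *)
Lemma lnorm_le_seq (R : realType) (X : choiceType) (p : \bar R)
    (f : X -> R[i]) (w : X -> R) (s : seq X) :
  (1 <= p)%E -> uniq s -> (forall x, 0 <= w x) ->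
  (forall x, x \notin s -> f x = 0) ->
  (forall x, x \in s -> Normc.normc (f x) <= w x `^ expo p) ->
  (lnorm p f <= ((\sum_(x <- s) w x) `^ expo p)%:E)%E.
Proof.
case: p => [r| |] // p1 us w0 f0 fw; last first.
  rewrite expoy powRr0 /lnorm; apply: ge_ereal_sup => _ [x _ <-]; rewrite lee_fin.
  have [/fw|/f0 ->] := boolP (x \in s); first by rewrite expoy powRr0.
  by rewrite Normc.normc0.
rewrite lee_fin in p1; have r0 : 0 < r by exact: lt_le_trans p1.
rewrite expo_fin -poweR_EFin /lnorm; apply: gt0_ler_poweR.
- by rewrite invr_ge0 ltW.
- by rewrite in_itv /= leey andbT; apply: esum_ge0 => x _; rewrite lee_fin powR_ge0.
- by rewrite in_itv /= leey andbT lee_fin sumr_ge0.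
have -> : (\esum_(x in setT) (Normc.normc (f x) `^ r)%:E =
          \esum_(x in [set` s]) (Normc.normc (f x) `^ r)%:E)%E.
  rewrite [RHS]esum_mkcond; apply: eq_esum => x _.
  rewrite mem_setE; case: ifPn => // /f0 ->.
  by rewrite Normc.normc0 powR0 ?gt_eqF.
rewrite esum_fset //; last by move=> x _; rewrite lee_fin powR_ge0.
rewrite -fsbig_seq // sumEFin lee_fin [leLHS]big_seq [leRHS]big_seq.
apply: ler_sum => x /fw; rewrite expo_fin => fx.
rewrite -[leRHS]powRr1 ?w0 // -(mulVf (lt0r_neq0 r0)) powRrM.
by apply: ge0_ler_powR => //; rewrite ?nnegrE ?powR_ge0 ?normc_ge0 // ltW.
Qed.

(** The constant c stands outside the power since for q = +oo it cannot be
    absorbed in w.  In that case the power of the sum is 1 even when the sum is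
    empty, so s has to be nonempty. *)
Lemma lnorm_ge_seq (R : realType) (X : choiceType) (q : \bar R)
    (g : X -> R[i]) (w : X -> R) (s : seq X) (c : R) :
  (1 <= q)%E -> uniq s -> s != [::] -> (forall x, 0 <= w x) -> 0 <= c ->
  (forall x, x \in s -> c * w x `^ expo q <= Normc.normc (g x)) ->
  ((c * (\sum_(x <- s) w x) `^ expo q)%:E <= lnorm q g)%E.
Proof.
case: q => [r| |] // q1 us s0 w0 c0 gw; last first.
  case: s s0 gw {us} => // x s _ /(_ x (mem_head x s)).
  rewrite expoy !powRr0 -lee_fin => /le_trans; apply.
  by apply: ereal_sup_ubound; exists x.
rewrite lee_fin in q1; have r0 : 0 < r by exact: lt_le_trans q1.
have sw0 : 0 <= \sum_(x <- s) w x by rewrite sumr_ge0.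
have -> : c * (\sum_(x <- s) w x) `^ expo r%:E =
          (c `^ r * \sum_(x <- s) w x) `^ r^-1.
  by rewrite expo_fin powRM ?powR_ge0 // -powRrM mulfV ?gt_eqF // powRr1.
rewrite -poweR_EFin /lnorm; apply: gt0_ler_poweR.
- by rewrite invr_ge0 ltW.
- by rewrite in_itv /= leey andbT lee_fin mulr_ge0 ?powR_ge0.
- by rewrite in_itv /= leey andbT; apply: esum_ge0 => x _; rewrite lee_fin powR_ge0.
apply: (@le_trans _ _ (\esum_(x in [set` s]) (Normc.normc (g x) `^ r)%:E)%E).
  rewrite esum_fset //; last by move=> x _; rewrite lee_fin powR_ge0.
  rewrite -fsbig_seq // sumEFin lee_fin mulr_sumr [leLHS]big_seq [leRHS]big_seq.
  apply: ler_sum => x /gw; rewrite expo_fin => gx.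
  have -> : c `^ r * w x = (c * w x `^ r^-1) `^ r.
    by rewrite powRM ?powR_ge0 // -powRrM mulVf ?gt_eqF // powRr1.
  by apply: ge0_ler_powR => //; rewrite ?nnegrE ?mulr_ge0 ?powR_ge0 ?normc_ge0 // ltW.
rewrite esum_mkcond; apply: le_esum => x _; case: ifP => // _.
by rewrite lee_fin powR_ge0.
Qed.

(** * Testing the operator on nonnegative functions *)

(** All terms are nonnegative, so dropping those outside D can only decrease
    the sum. *)
Lemma T_lambda_ge_sum (R : realType) (k : nat) (lambda : R) (g : Z2k1 k -> R)
    (s : seq (Z2k1 k)) (D : seq (Z2k k)) (n : Z2k k) (t : int) :
  (forall x, 0 <= g x) -> (forall x, x \notin s -> g x = 0) ->
  uniq D -> 0 \notin D ->
  \sum_(m <- D) g (n - m, t - omega n m) / enorm R m `^ (2 * k%:R * lambda)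
  <= Normc.normc (T_lambda lambda (fun x => real_complex R (g x)) (n, t)).
Proof.
move=> g0 gs uD D0.
pose h m := g (n - m, t - omega n m) / enorm R m `^ (2 * k%:R * lambda).
have h0 m : 0 <= h m by rewrite mulr_ge0 // invr_ge0 powR_ge0.
(* A finite set containing D and every m for which the summand is nonzero: the
   latter requires n - m to be the first component of a point of s. *)
pose E := undup (D ++ [seq m <- [seq n - x.1 | x <- s] | m != 0]).
have E0 m : m \in E -> m != 0.
  rewrite mem_undup mem_cat mem_filter; case/orP => [mD|/andP[]//].
  by apply: contraNneq D0 => <-.
have -> : T_lambda lambda (fun x => real_complex R (g x)) (n, t)
       = real_complex R (\sum_(m <- E) h m).
  rewrite /T_lambda (@fsbigE _ _ _ _ _ E) ?undup_uniq //.
  - rewrite rmorph_sum [RHS]big_seq [LHS]big_seq_cond; apply: eq_big => [m|m _].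
      by case: (boolP (m \in E)) => //= /E0 m0; rewrite mem_set.
    by rewrite rmorphM fmorphV.
  - move=> m /= m0; rewrite mem_undup mem_cat mem_filter m0 /= negb_or.
    move=> /andP[_ mE]; rewrite gs ?rmorph0 ?mul0r //.
    apply: contra mE => xs; apply/mapP; exists (n - m, t - omega n m) => //=.
    by rewrite opprB addrC subrK.
rewrite normc_real ger0_norm ?sumr_ge0 // [leRHS](bigID (mem D)) /=.
have -> : \sum_(m <- E | m \in D) h m = \sum_(m <- D) h m.
  rewrite -big_filter; apply: perm_big; apply: uniq_perm; rewrite ?filter_uniq ?undup_uniq //.
  by move=> m; rewrite mem_filter mem_undup mem_cat; case: (m \in D).
by rewrite lerDl sumr_ge0.
Qed.
(** The form in which boundedness is used: w controls the size of g on its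
    support s, while c and w' witness that T g is large on s'. *)
Lemma bounded_test (R : realType) (k : nat) (lambda : R) (p q : \bar R) :
  (1 <= p)%E -> (1 <= q)%E ->
  extends_bounded (@T_lambda R k lambda) p q ->
  exists2 A : R, 0 <= A &
  forall (g w w' : Z2k1 k -> R) (s s' : seq (Z2k1 k)) (c : R),
    (forall x, 0 <= g x) -> (forall x, x \notin s -> g x = 0) ->
    uniq s -> (forall x, 0 <= w x) ->
    (forall x, x \in s -> g x <= w x `^ expo p) ->
    uniq s' -> s' != [::] -> (forall x, 0 <= w' x) -> 0 <= c ->
    (forall x, x \in s' -> c * w' x `^ expo q <=
      Normc.normc (T_lambda lambda (fun x => real_complex R (g x)) x)) ->
  c * (\sum_(x <- s') w' x) `^ expo q <= A * (\sum_(x <- s) w x) `^ expo p.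
Proof.
move=> p1 q1 [A TA]; exists `|A| => // g w w' s s' c g0 gs us w0 gw us' s'0 w'0 c0 cT.
pose f x := real_complex R (g x).
have ff : finitely_supported f.
  apply: (sub_finite_set _ (finite_seq s)) => x /= fx.
  by apply: contraNT fx => /gs; rewrite /f => ->; rewrite rmorph0.
have lf : (lnorm p f <= ((\sum_(x <- s) w x) `^ expo p)%:E)%E.
  apply: lnorm_le_seq => // x; first by rewrite /f => /gs ->; rewrite rmorph0.
  by move=> /gw; rewrite /f normc_real ger0_norm.
have lf0 : (0 <= lnorm p f)%E.
  case: (p) => [r| |] //; rewrite /lnorm; first exact: poweR_ge0.
  apply: le_trans (_ : ((Normc.normc (f 0))%:E <= _)%E).
    by rewrite lee_fin normc_ge0.
  by apply: ereal_sup_ubound; exists 0.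
rewrite -lee_fin; apply: le_trans (lnorm_ge_seq q1 us' s'0 w'0 c0 cT) _.
apply: le_trans (TA f ff) _.
apply: (@le_trans _ _ (`|A|%:E * lnorm p f)%E).
  by apply: lee_wpmul2r => //; rewrite lee_fin ler_norm.
by rewrite EFinM; apply: lee_wpmul2l.
Qed.

Lemma powR_unbounded (R : realType) (e B C : R) : 0 < e -> 0 < C ->
  exists2 M : R, 1 <= M & forall x, M <= x -> B < C * x `^ e.
Proof.
move=> e0 C0; have y1 : 1 <= `|B| / C + 1 by rewrite lerDr divr_ge0 // ltW.
have y0 := le_trans ler01 y1.
exists ((`|B| / C + 1) `^ e^-1) => [|x yx].
  apply: (@le_trans _ _ (1 `^ e^-1)); first by rewrite powR1.
  by apply: ge0_ler_powR; rewrite ?nnegrE ?invr_ge0 // ltW.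
have ye : `|B| / C + 1 <= x `^ e.
  have -> : `|B| / C + 1 = ((`|B| / C + 1) `^ e^-1) `^ e.
    by rewrite -powRrM mulVf ?gt_eqF // powRr1.
  apply: ge0_ler_powR; rewrite ?nnegrE ?powR_ge0 //; first exact: ltW.
  by apply: le_trans yx; exact: powR_ge0.
apply: lt_le_trans (_ : C * (`|B| / C + 1) <= _); last by rewrite ler_pM2l.
by rewrite mulrDr mulr1 mulrCA mulfV ?gt_eqF // mulr1 (le_lt_trans (ler_norm B)) ?ltrDl.
Qed.

(** * Sizes of omega and of the Euclidean norm *)

Definition coord_bounded (k : nat) (M : nat) (m : Z2k k) : Prop :=
  forall i, `|m.1 0 i| <= M%:Z /\ `|m.2 0 i| <= M%:Z.

Lemma dot_bound (k : nat) (M : nat) (u v : 'rV[int]_k) :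
  (forall i, `|u 0 i| <= M%:Z) -> (forall i, `|v 0 i| <= M%:Z) ->
  `|dot u v| <= k%:Z * M%:Z ^+ 2.
Proof.
move=> uM vM; apply: le_trans (ler_norm_sum _ _ _) _.
apply: le_trans (_ : \sum_(i < k) M%:Z ^+ 2 <= _).
  by apply: ler_sum => i _; rewrite normrM expr2 ler_pM.
by rewrite sumr_const card_ord -mulr_natl natz.
Qed.

Lemma omega_bound (k : nat) (M : nat) (n m : Z2k k) :
  coord_bounded M n -> coord_bounded M m ->
  `|omega n m| <= 4 * k%:Z * M%:Z ^+ 2.
Proof.
move=> nM mM.
have h1 := @dot_bound k M n.2 m.1 (fun i => (nM i).2) (fun i => (mM i).1).
have h2 := @dot_bound k M n.1 m.2 (fun i => (nM i).1) (fun i => (mM i).2).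
rewrite /omega; move: h1 h2; lia.
Qed.

Lemma enorm_le (R : realType) (k : nat) (M : nat) (m : Z2k k) :
  (1 <= k)%N -> coord_bounded M m -> enorm R m <= 2 * k%:R * M%:R.
Proof.
move=> k1 mM.
have h1 := @dot_bound k M m.1 m.1 (fun i => (mM i).1) (fun i => (mM i).1).
have h2 := @dot_bound k M m.2 m.2 (fun i => (mM i).2) (fun i => (mM i).2).
have r0 : 0 <= 2 * k%:R * M%:R :> R by rewrite !mulr_ge0.
rewrite /enorm -[leRHS]ger0_norm // -sqrtr_sqr ler_wsqrtr //.
have -> : (2 * k%:R * M%:R) ^+ 2 = (((2 * k%:Z * M%:Z) ^+ 2)%:~R : R).
  by rewrite rmorphXn !rmorphM.
rewrite ler_int; nia.
Qed.

Lemma dot_ge0 (k : nat) (u : 'rV[int]_k) : 0 <= dot u u.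
Proof. by apply: sumr_ge0 => i _; rewrite -expr2 sqr_ge0. Qed.

Lemma dot_gt0 (k : nat) (u : 'rV[int]_k) : u != 0 -> 0 < dot u u.
Proof.
move=> u0; rewrite lt_neqAle dot_ge0 andbT; apply: contra u0 => /eqP/esym d0.
apply/eqP/rowP => i; rewrite mxE; apply/eqP; rewrite -sqrf_eq0 expr2; apply/eqP.
move: i (erefl true); apply: (psumr_eq0P _ d0) => i _.
by rewrite -expr2 sqr_ge0.
Qed.

Lemma enorm_ge1 (R : realType) (k : nat) (m : Z2k k) : m != 0 -> 1 <= enorm R m.
Proof.
case: m => u v uv; rewrite /enorm -[leLHS]sqrtr1 ler_wsqrtr // -[leLHS]/(1%:~R) ler_int.
have := dot_ge0 u; have := dot_ge0 v; rewrite /=.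
have [u0|/dot_gt0] := eqVneq u 0; last by lia.
have [v0|/dot_gt0] := eqVneq v 0; last by lia.
by rewrite u0 v0 eqxx in uv.
Qed.

(** * Cubes and the divergence of the sum of |m|^(-2k) *)

Definition shift_mx (k : nat) (a : int) (N : nat) (u : 'rV['I_N]_k) : 'rV[int]_k :=
  map_mx (fun i : 'I_N => a + i%:Z) u.

Definition cube (k : nat) (a : int) (N : nat) : seq (Z2k k) :=
  [seq (shift_mx a u.1, shift_mx a u.2) | u : 'rV['I_N]_k * 'rV['I_N]_k].

Lemma shift_mx_inj (k : nat) (a : int) (N : nat) : injective (@shift_mx k a N).
Proof.
move=> u v /rowP uv; apply/rowP => i; apply: val_inj.
by have := uv i; rewrite !mxE => /addrI [].
Qed.

Lemma cube_uniq (k : nat) (a : int) (N : nat) : uniq (cube k a N).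
Proof.
rewrite map_inj_uniq ?enum_uniq //.
by move=> [u1 u2] [v1 v2] [] /shift_mx_inj -> /shift_mx_inj ->.
Qed.

Lemma size_cube (k : nat) (a : int) (N : nat) : size (cube k a N) = (N ^ (2 * k))%N.
Proof. by rewrite size_map -cardE card_prod card_mx card_ord mul1n mul2n -addnn expnD. Qed.

Lemma shift_mxP (k : nat) (a : int) (N : nat) (m : 'rV[int]_k) :
  (forall i, a <= m 0 i < a + N%:Z) -> exists u, m = @shift_mx k a N u.
Proof.
move=> mN; have lt i : (absz (m 0 i - a)%R < N)%N by have := mN i; lia.
exists (\row_i Ordinal (lt i)); apply/rowP => i; rewrite !mxE /=.
by have := mN i; lia.
Qed.

Lemma mem_cube (k : nat) (a : int) (N : nat) (m : Z2k k) :
  m \in cube k a N <->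
  (forall i, a <= m.1 0 i < a + N%:Z /\ a <= m.2 0 i < a + N%:Z).
Proof.
split=> [/mapP[u _ ->] i /=|mN].
  by rewrite !mxE; case: (u.1 0 i) (u.2 0 i) => x xN [y yN] /=; lia.
have [u1 m1] := @shift_mxP k a N m.1 (fun i => (mN i).1).
have [u2 m2] := @shift_mxP k a N m.2 (fun i => (mN i).2).
apply/mapP; exists (u1, u2); rewrite ?mem_enum //=.
by rewrite -m1 -m2; case: (m).
Qed.

Lemma cube_bounded (k : nat) (a N M : nat) (m : Z2k k) :
  (a + N <= M.+1)%N -> m \in cube k a N -> coord_bounded M m.
Proof. by move=> aM /mem_cube mN i; have := mN i; lia. Qed.

Lemma cube_neq0 (k : nat) (a N : nat) (m : Z2k k) :
  (0 < k)%N -> (0 < a)%N -> m \in cube k a N -> m != 0.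
Proof.
move=> k0 a0 /mem_cube mN; apply/eqP => m0.
have := mN (Ordinal k0); rewrite m0 /= !mxE; lia.
Qed.

(** The cube has N^(2k) points, and a > 0 keeps it away from the origin. *)
Lemma sum_cube_ge (R : realType) (k : nat) (a N M : nat) (r : R) :
  (0 < k)%N -> (0 < a)%N -> (a + N <= M.+1)%N -> 0 <= r ->
  N%:R ^+ (2 * k) * (2 * k%:R * M%:R) `^ (- r) <=
  \sum_(m <- cube k a N) enorm R m `^ (- r).
Proof.
move=> k0 a0 aM r0.
have -> : N%:R ^+ (2 * k) * (2 * k%:R * M%:R) `^ (- r) =
  \sum_(m <- cube k a N) (2 * k%:R * M%:R : R) `^ (- r).
  by rewrite big_const_seq count_predT size_cube iter_addr_0 -natrX mulr_natl.
rewrite [leLHS]big_seq [leRHS]big_seq; apply: ler_sum => m mC.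
have m1 : 1 <= enorm R m by apply: enorm_ge1; exact: cube_neq0 mC.
have mM := enorm_le R k0 (cube_bounded aM mC).
have e0 := lt_le_trans ltr01 m1.
have M0 := lt_le_trans e0 mM.
rewrite !powRN lef_pV2 ?posrE ?powR_gt0 //.
by apply: ge0_ler_powR; rewrite ?nnegrE // ltW.
Qed.

(** The cubes [2^J, 2^(J+1))^(2k) are pairwise disjoint, and each contributes at
    least the same constant c: it has 2^(2kJ) points, all of norm at most
    2k 2^(J+1) = 4k 2^J. *)
Lemma sum_enorm_unbounded (R : realType) (k : nat) (B : R) : (0 < k)%N ->
  exists s : seq (Z2k k), [/\ uniq s, 0 \notin s &
    B <= \sum_(m <- s) enorm R m `^ (- (2 * k%:R))].
Proof.
move=> k0; pose c : R := (4 * k%:R) `^ (- (2 * k%:R)).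
have c0 : 0 < c by rewrite powR_gt0 // mulr_gt0 // ltr0n.
(* The bound on the first coordinate is what makes the next cube disjoint from
   the points collected so far. *)
have shell J : exists s : seq (Z2k k), [/\ uniq s,
    forall m, m \in s -> m != 0 /\ m.1 0 (Ordinal k0) < (2 ^ J)%:Z &
    J%:R * c <= \sum_(m <- s) enorm R m `^ (- (2 * k%:R))].
  elim: J => [|J [s [us sJ sc]]]; first by exists [::]; rewrite big_nil mul0r.
  have J0 : (0 < 2 ^ J)%N by rewrite expn_gt0.
  exists (cube k (2 ^ J)%N (2 ^ J) ++ s); split.
  - rewrite cat_uniq cube_uniq us andbT /=; apply/hasPn => m /sJ[_ mJ].
    by apply/negP => /mem_cube /(_ (Ordinal k0)) [/andP[]]; rewrite leNgt mJ.
  - move=> m; rewrite mem_cat => /orP[mC|/sJ[m0 mJ]].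
      split; first exact: cube_neq0 mC.
      move/mem_cube: mC => /(_ (Ordinal k0)) []; rewrite expnS.
      by move: (m.1 _ _) (m.2 _ _) (2 ^ J)%N => x y N; lia.
    by split=> //; rewrite expnS; lia.
  - rewrite big_cat /= -natr1 mulrDl mul1r addrC lerD //.
    have -> : c = (2 ^ J)%:R ^+ (2 * k) * (2 * k%:R * (2 ^ J.+1)%:R) `^ (- (2 * k%:R)).
      have -> : 2 * k%:R * (2 ^ J.+1)%:R = 4 * k%:R * (2 ^ J)%:R :> R.
        by rewrite expnS natrM; ring.
      rewrite powRM ?mulr_ge0 // -/c mulrC -mulrA [X in c * X]mulrC.
      rewrite powRN -natrM powR_mulrn // mulfV ?mulr1 //.
    by apply: sum_cube_ge => //; rewrite ?mulr_ge0 // expnS; lia.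
have [s [us sJ sc]] := shell (Num.bound `|B / c|).
exists s; split=> //; first by apply/negP => /sJ[]; rewrite eqxx.
apply: le_trans sc; rewrite -ler_pdivrMr // ltW //.
exact: le_lt_trans (ler_norm _) (archi_boundP (normr_ge0 _)).
Qed.

(** * Lower bound for 1/p and upper bound for 1/q *)

Lemma omega_diag (k : nat) (n : Z2k k) : omega n n = 0.
Proof.
rewrite /omega (_ : dot n.2 n.1 = dot n.1 n.2) ?subrr ?mulr0 //.
by apply: eq_bigr => i _; rewrite mulrC.
Qed.

Lemma omega0l (k : nat) (m : Z2k k) : omega 0 m = 0.
Proof. by rewrite /omega /dot !big1 ?subrr ?mulr0 // => i _; rewrite mxE mul0r. Qed.

Lemma enormN (R : realType) (k : nat) (m : Z2k k) : enorm R (- m) = enorm R m.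
Proof.
have dotNN (u : 'rV[int]_k) : dot (- u) (- u) = dot u u.
  by apply: eq_bigr => i _; rewrite mxE mulrNN.
by rewrite /enorm /= !dotNN.
Qed.

(** Tested on the point mass at the origin, whose image at (m, 0) is at least
    |m|^(-2k lambda), hence at least (|m|^(-2k))^(1/q) if lambda <= 1/q. *)
Lemma bounded_expo_q (R : realType) (k : nat) (lambda : R) (p q : \bar R) :
  (1 <= k)%N -> 0 < lambda < 1 -> (1 <= p)%E -> (1 <= q)%E ->
  extends_bounded (@T_lambda R k lambda) p q -> expo q < lambda.
Proof.
move=> k1 /andP[l0 l1] p1 q1 /(bounded_test p1 q1) [A A0 test].
rewrite ltNge; apply/negP => lq; have q0 := lt_le_trans l0 lq.
have [M M1 AM] := @powR_unbounded R (expo q) A 1 q0 ltr01.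
have [s [us s0 Ms]] := @sum_enorm_unbounded R k M k1.
pose w' (x : Z2k1 k) : R := enorm R x.1 `^ (- (2 * k%:R)).
pose g (x : Z2k1 k) : R := (x == 0)%:R.
suff : 1 * (\sum_(x <- [seq (m, 0) | m <- s]) w' x) `^ expo q <=
    A * (\sum_(x <- [:: 0 : Z2k1 k]) 1) `^ expo p.
  rewrite big_map big_seq1 powR1 mulr1 leNgt; apply/negP/negPn; exact: AM.
apply: (test g) => //.
- by move=> x; rewrite inE /g => /negPf ->.
- by move=> x _; rewrite powR1 /g lern1 leq_b1.
- by rewrite map_inj_uniq // => m m' [].
- case: s {us s0} Ms => // /(le_trans M1); rewrite big_nil.
  by rewrite ler10.
- by move=> x; exact: powR_ge0.
- move=> _ /mapP[m ms ->].
  have m0 : m != 0 by apply: contraNneq s0 => <-.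
  have m1 := enorm_ge1 R m0.
  apply: (@le_trans _ _ (\sum_(m' <- [:: m])
     g (m - m', 0 - omega m m') / enorm R m' `^ (2 * k%:R * lambda))); last first.
    apply: (@T_lambda_ge_sum R k lambda g [:: 0]) => //.
    - by move=> x; rewrite inE /g => /negPf ->.
    - by rewrite inE eq_sym.
  rewrite big_seq1 !subrr omega_diag subr0 /g eqxx !mul1r /w' /= -powRrM -powRN.
  by rewrite ler_powR // mulNr lerN2 ler_wpM2l // mulr_ge0.
Qed.

(** The function g = |m|^(-2k(1 - lambda)) is chosen so that its product with
    the kernel is |m|^(-2k); placing it at the points (-m, 0) makes all these
    products add up at the origin. *)
Lemma bounded_expo_p (R : realType) (k : nat) (lambda : R) (p q : \bar R) :
  (1 <= k)%N -> 0 < lambda < 1 -> (1 <= p)%E -> (1 <= q)%E ->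
  extends_bounded (@T_lambda R k lambda) p q -> 1 - lambda < expo p.
Proof.
move=> k1 /andP[l0 l1] p1 q1 /(bounded_test p1 q1) [A A0 test].
rewrite ltNge; apply/negP => pl.
have [M M1 AM] := @powR_unbounded R lambda A 1 l0 ltr01.
have [s [us s0 Ms]] := @sum_enorm_unbounded R k M k1.
pose c := \sum_(m <- s) enorm R m `^ (- (2 * k%:R)); rewrite -/c in Ms.
have c1 : 1 <= c := le_trans M1 Ms; have c0 := lt_le_trans ltr01 c1.
pose w (x : Z2k1 k) : R := enorm R x.1 `^ (- (2 * k%:R)).
pose r : seq (Z2k1 k) := [seq (- m, 0) | m <- s].
pose g (x : Z2k1 k) : R :=
  if x \in r then enorm R x.1 `^ (- (2 * k%:R) * (1 - lambda)) else 0.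
have g0 x : 0 <= g x by rewrite /g; case: ifP => // _; exact: powR_ge0.
have gr x : x \notin r -> g x = 0 by rewrite /g => /negPf ->.
suff : c * (\sum_(x <- [:: 0 : Z2k1 k]) 1) `^ expo q <=
    A * (\sum_(x <- r) w x) `^ expo p.
  rewrite big_map big_seq1 powR1 mulr1.
  have -> : \sum_(m <- s) w (- m, 0) = c by apply: eq_bigr => m _; rewrite /w enormN.
  move=> cA; have : c <= A * c `^ (1 - lambda).
    by apply: le_trans cA _; rewrite ler_wpM2l // ler_powR.
  have {1}-> : c = c `^ lambda * c `^ (1 - lambda).
    by rewrite -powRD ?(lt0r_neq0 c0) ?implybT // subrKC powRr1 // ltW.
  by rewrite ler_pM2r ?powR_gt0 // leNgt -[X in A < X]mul1r AM.
apply: (test g) => //.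
- rewrite map_inj_uniq // => m m' mm'; apply: oppr_inj.
  exact: (congr1 fst mm').
- by move=> x; exact: powR_ge0.
- move=> x xr; rewrite /g xr /w -powRrM.
  have x0 : x.1 != 0.
    move/mapP: xr => [m ms ->] /=; rewrite oppr_eq0.
    by apply: contraNneq s0 => <-.
  rewrite ler_powR ?enorm_ge1 // !mulNr lerN2 ler_wpM2l // mulr_ge0 //.
- exact: ltW.
- move=> x; rewrite inE => /eqP ->; rewrite powR1 mulr1.
  apply: le_trans (@T_lambda_ge_sum R k lambda g r s 0 0 g0 gr us s0).
  rewrite le_eqVlt; apply/orP; left; apply/eqP; rewrite /c [LHS]big_seq [RHS]big_seq.
  apply: eq_bigr => m ms; rewrite omega0l subr0 sub0r /g.
  have -> : (- m, 0) \in r by apply/mapP; exists m.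
  have m0 : m != 0 by apply: contraNneq s0 => <-.
  have m1 := lt_le_trans ltr01 (enorm_ge1 R m0).
  rewrite /= enormN -powRN -powRD ?(lt0r_neq0 m1) ?implybT //.
  by congr (_ `^ _); ring.
Qed.

(** * The scaling condition *)

Definition interval_seq (a : int) (L : nat) : seq int :=
  [seq a + i%:Z | i <- iota 0 L].

Lemma interval_seq_uniq (a : int) (L : nat) : uniq (interval_seq a L).
Proof. by rewrite map_inj_uniq ?iota_uniq // => i j /addrI []. Qed.

Lemma size_interval_seq (a : int) (L : nat) : size (interval_seq a L) = L.
Proof. by rewrite size_map size_iota. Qed.

Lemma mem_interval_seq (a : int) (L : nat) (t : int) :
  (t \in interval_seq a L) = (a <= t < a + L%:Z).
Proof.
apply/mapP/idP => [ex|at_].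
  by case: ex => i; rewrite mem_iota => ? ->; lia.
by exists (absz (t - a)); [rewrite mem_iota; lia | lia].
Qed.

Definition box (k : nat) (a : int) (N : nat) (b : int) (L : nat) : seq (Z2k1 k) :=
  [seq (n, t) | n <- cube k a N, t <- interval_seq b L].

Lemma box_uniq (k : nat) (a : int) (N : nat) (b : int) (L : nat) :
  uniq (box k a N b L).
Proof.
by rewrite allpairs_uniq ?cube_uniq ?interval_seq_uniq // => -[? ?] [? ?] _ _ [-> ->].
Qed.

Lemma size_box (k : nat) (a : int) (N : nat) (b : int) (L : nat) :
  size (box k a N b L) = (N ^ (2 * k) * L)%N.
Proof. by rewrite size_allpairs size_cube size_interval_seq. Qed.

Lemma mem_box (k : nat) (a : int) (N : nat) (b : int) (L : nat) (n : Z2k k) (t : int) :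
  ((n, t) \in box k a N b L) = (n \in cube k a N) && (t \in interval_seq b L).
Proof.
apply/allpairsP/andP => [[[n' t'] [? ? [-> ->]]] //|[nC tI] ].
by exists (n, t).
Qed.

(** With n and m in [1, N]^(2k), the coordinates of n - m lie in (-N, N) and
    |omega(n, m)| <= 4k N^2, whence the length 4k N^2 + N^2 + 4k N^2 of the
    central side of the larger box. *)
Lemma box_sub (k N : nat) (n m : Z2k k) (t : int) :
  (n, t) \in box k 1 N 0 (N ^ 2) -> m \in cube k 1 N ->
  (n - m, t - omega n m) \in
    box k (- N%:Z) (2 * N) (- (4 * k%:Z * N%:Z ^+ 2)) ((8 * k + 1) * N ^ 2).
Proof.
rewrite !mem_box !mem_interval_seq => /andP[nC tN] mC.
have nN : coord_bounded N n by apply: (@cube_bounded k 1 N N).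
have mN : coord_bounded N m by apply: (@cube_bounded k 1 N N).
apply/andP; split.
  apply/mem_cube => i; rewrite !mxE.
  move/mem_cube: nC => /(_ i); move/mem_cube: mC => /(_ i).
  by move: (n.1 0 i) (n.2 0 i) (m.1 0 i) (m.2 0 i) => x y z u; lia.
have := omega_bound nN mN.
have -> : Posz ((8 * k + 1) * N ^ 2)%N = (8 * k%:Z + 1) * N%:Z ^+ 2.
  by rewrite PoszM PoszD PoszM -natrXE rmorphXn.
move: tN; have -> : Posz (N ^ 2)%N = N%:Z ^+ 2 by rewrite -natrXE rmorphXn.
move: (omega n m) (N%:Z ^+ 2) => x y; lia.
Qed.

Lemma sum1_seq (R : realType) (X : choiceType) (s : seq X) :
  \sum_(x <- s) (1 : R) = (size s)%:R.
Proof. by rewrite big_const_seq count_predT iter_addr_0. Qed.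

(** Tested on the indicator of the larger box of [box_sub]: at each point of the
    smaller box, all m in the cube [1, N]^(2k) contribute fully to T g. *)
Lemma box_inequality (R : realType) (k : nat) (lambda : R) (p q : \bar R) :
  (1 <= k)%N -> 0 < lambda < 1 -> (1 <= p)%E -> (1 <= q)%E ->
  extends_bounded (@T_lambda R k lambda) p q ->
  exists2 A : R, 0 <= A & forall N : nat, (0 < N)%N ->
    N%:R ^+ (2 * k) * (2 * k%:R * N%:R) `^ (- (2 * k%:R * lambda)) *
      (N ^ (2 * k) * N ^ 2)%:R `^ expo q <=
    A * ((2 * N) ^ (2 * k) * ((8 * k + 1) * N ^ 2))%:R `^ expo p.
Proof.
move=> k1 /andP[l0 l1] p1 q1 /(bounded_test p1 q1) [A A0 test].
exists A => // N N0.
pose B := box k (- N%:Z) (2 * N) (- (4 * k%:Z * N%:Z ^+ 2)) ((8 * k + 1) * N ^ 2).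
pose B' := box k 1 N 0 (N ^ 2).
pose c : R := \sum_(m <- cube k 1 N) enorm R m `^ (- (2 * k%:R * lambda)).
pose g (x : Z2k1 k) : R := (x \in B)%:R.
have g0 x : 0 <= g x by rewrite /g ler0n.
have gB x : x \notin B -> g x = 0 by rewrite /g => /negPf ->.
have r0 : 0 <= 2 * k%:R * lambda by rewrite !mulr_ge0 // ltW.
have cN := @sum_cube_ge R k 1 N N _ k1 isT (leqnn N.+1) r0.
suff : c * (\sum_(x <- B') 1) `^ expo q <= A * (\sum_(x <- B) 1) `^ expo p.
  rewrite !sum1_seq !size_box; apply: le_trans.
  by rewrite ler_wpM2r ?powR_ge0.
apply: (test g) => //.
- exact: box_uniq.
- by move=> x xB; rewrite powR1 /g xB.
- exact: box_uniq.
- by rewrite -size_eq0 size_box -lt0n muln_gt0 !expn_gt0 N0.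
- by apply: sumr_ge0 => m _; exact: powR_ge0.
- move=> [n t] nB; rewrite powR1 mulr1.
  have C0 : 0 \notin cube k 1 N.
    by apply/negP => /(@cube_neq0 k 1 N _ k1 isT); rewrite eqxx.
  apply: le_trans (@T_lambda_ge_sum R k lambda g B _ n t g0 gB (cube_uniq k 1 N) C0).
  rewrite [leLHS]big_seq [leRHS]big_seq; apply: ler_sum => m mC.
  by rewrite /g box_sub // mul1r powRN.
Qed.

(** Collecting powers of N in [box_inequality] gives C N^e <= A K^(1/p) for all
    N > 0, where e = 2k(1 - lambda) + (2k + 2)(1/q - 1/p) and where C > 0 and K do
    not depend on N.  Hence e <= 0, which is the
    claim. *)
Lemma bounded_scaling (R : realType) (k : nat) (lambda : R) (p q : \bar R) :
  (1 <= k)%N -> 0 < lambda < 1 -> (1 <= p)%E -> (1 <= q)%E ->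
  extends_bounded (@T_lambda R k lambda) p q ->
  expo q <= expo p - (2 * k%:R * (1 - lambda)) / (2 * k%:R + 2).
Proof.
move=> k1 l01 p1 q1 /(box_inequality k1 l01 p1 q1) [A A0 test].
have k0 : 0 < k%:R :> R by rewrite ltr0n.
pose d : R := 2 * k%:R + 2.
have d0 : 0 < d by rewrite /d; lra.
pose K : R := 2 `^ (2 * k%:R) * (8 * k%:R + 1).
have K0 : 0 < K by rewrite mulr_gt0 ?powR_gt0 //; lra.
pose e : R := 2 * k%:R * (1 - lambda) + d * expo q - d * expo p.
have e0 : e <= 0.
  rewrite leNgt; apply/negP => e0.
  have C0 : 0 < (2 * k%:R) `^ (- (2 * k%:R * lambda)) :> R by rewrite powR_gt0 ?mulr_gt0.
  have [M M1 AM] := powR_unbounded (A * K `^ expo p) e0 C0.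
  have MN : M <= (Num.bound M)%:R.
    by rewrite ltW // archi_boundP // (le_trans ler01).
  pose N := Num.bound M; rewrite -/N in MN; have x1 := le_trans M1 MN.
  have N0 : (0 < N)%N by rewrite -(ltr0n R) (lt_le_trans ltr01).
  have := AM _ MN; apply/negP; rewrite -leNgt.
  have := test N N0; set x : R := N%:R; rewrite -/x in x1.
  have x0 : 0 < x by exact: lt_le_trans x1.
  have xd : (N ^ (2 * k) * N ^ 2)%:R = x `^ d.
    by rewrite natrM !natrX -!powR_mulrn ?ltW // -powRD ?(lt0r_neq0 x0) ?implybT // natrM.
  have Kd : ((2 * N) ^ (2 * k) * ((8 * k + 1) * N ^ 2))%:R = K * x `^ d.
    rewrite -xd expnMn mulnACA -mulnA natrM [in LHS]natrM.
    by rewrite /K natrX natrD natrM -powR_mulrn // natrM; ring.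
  rewrite xd Kd -powR_mulrn ?(ltW x0) // natrM.
  rewrite (powRM (expo p)) ?powR_ge0 ?(ltW K0) // -!powRrM.
  rewrite (powRM (- _)) ?mulr_ge0 ?(ltW x0) //.
  move=> H; rewrite -(ler_pM2r (powR_gt0 (d * expo p) x0)).
  rewrite -[leLHS]mulrA -powRD ?(lt0r_neq0 x0) ?implybT //.
  rewrite -[leRHS]mulrA; apply: le_trans H.
  rewrite mulrCA -!mulrA -!powRD ?(lt0r_neq0 x0) ?implybT //.
  by rewrite le_eqVlt; apply/orP; left; apply/eqP; congr (_ * _ `^ _); rewrite /e; ring.
rewrite -(ler_pM2l d0) mulrBr [d * (_ / _)]mulrC -/d divfK ?gt_eqF //.
move: e0; rewrite /e; lra.
Qed.

Unset Implicit Arguments.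
Set Strict Implicit.

(* Inverses of exponents are taken in \bar R, where +oo^-1 = 0. *)
Theorem mainTheorem2 (R : realType) (k : nat) (lambda : R) (p q : \bar R) :
  (1 <= k)%N -> 0 < lambda < 1 -> (1 <= p)%E -> (1 <= q)%E ->
  extends_bounded (@T_lambda R k lambda) p q ->
  (q^-1 <= p^-1 - ((2 * k%:R * (1 - lambda)) / (2 * k%:R + 2))%:E)%E
  /\ ((q^-1 < lambda%:E)%E /\ ((1 - lambda)%:E < p^-1)%E).
Proof.
move=> k1 l01 p1 q1 bT; rewrite !expoE // -EFinB lee_fin !lte_fin.
split; first exact: bounded_scaling bT.
by split; [exact: bounded_expo_q bT | exact: bounded_expo_p bT].
Qed.
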